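(* Fix real numbers $a>b>0$, an integer $k\ge3$ and $\varepsilon>0$. Let $p=\omega\,a/n$, $q=\omega\,b/n$ and $G\in\mathcal{G}(n,k,p,q)$ with planted partition $\mathcal{P}$. Let $0<\nu_1<\nu_2<1$ and $c,c_1,c_2>0$ be constants as provided by the overlap gap property, i.e. such that, whenever $\omega>c$ and $n$ is large enough, the following three properties hold simultaneously with probability at least $1-\varepsilon$, where $\mathcal{E}_{\rm close}=\{\mathcal{A}: d(\mathcal{P},\mathcal{A})\le\nu_1\}$, $\mathcal{E}_{\rm far}=\{\mathcal{A}: d(\mathcal{P},\mathcal{A})\ge\nu_2\}$, $\mathcal{E}_{\rm btw}=\{\mathcal{A}: d(\mathcal{P},\mathcal{A})\in(\nu_1,\nu_2)\}$ are sets of $k$-partitions of $[n]$: (i) $\arg\max_{\mathcal{A}}q_{\mathcal{A}}(G)\subseteq\mathcal{E}_{\rm close}$; (ii) $\max_{\mathcal{A}\in\mathcal{E}_{\rm far}}q_{\mathcal{A}}(G)\ge q^\star(G)-c_1$; (iii) $\max_{\mathcal{A}\in\mathcal{E}_{\rm btw}}q_{\mathcal{A}}(G)\le q^\star(G)-c_1-c_2$. Assume $\omega>c$ and let $\beta>0$ be a sufficiently large constant. Consider the Markov Chain Monte Carlo chain $(\mathcal{A}_t)_{t\ge0}$ with inverse temperature $\beta$ (defined in the context), initiated at the Gibbs distribution conditioned on being in $\mathcal{E}_{\rm far}$, namely $$\mathbb{P}(\mathcal{A}_0=\mathcal{A})=\frac{\mathbb{P}_{\rm Gibbs}(\mathcal{A})}{\sum_{\mathcal{B}\in\mathcal{E}_{\rm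 far}}\mathbb{P}_{\rm Gibbs}(\mathcal{B})}\quad\text{for all }\mathcal{A}\in\mathcal{E}_{\rm far},$$ and $\mathbb{P}(\mathcal{A}_0=\mathcal{A})=0$ otherwise. Let $\tau=\min\{t:\mathcal{A}_t\in\mathcal{E}_{\rm close}\}$. Then there exist constants $c_3,c_4>0$ such that, for $n$ large enough, with probability at least $1-\varepsilon$ with respect to the randomness of the graph $G$, $$\mathbb{P}\big(\tau\ge\exp(c_3n)\big)\ \ge\ 1-\exp(-c_4n),$$ where the latter probability is with respect to the random choices of the chain.
   Context: Modularity: for a graph $G=(V,E)$ with $m=|E|\ge1$ edges and a partition $\mathcal{A}$ of $V$, $q_{\mathcal{A}}(G)=\sum_{A\in\mathcal{A}}\frac{e(A)}{m}-\sum_{A\in\mathcal{A}}\left(\frac{\mathrm{vol}(A)}{\mathrm{vol}(V)}\right)^2$, where $e(A)$ is the number of edges inside $A$ and $\mathrm{vol}(A)=\sum_{v\in A}d_v$. $q^\star(G)=\max_{\mathcal{A}}q_{\mathcal{A}}(G)$. Stochastic block model $\mathcal{G}(n,k,p,q)$: the vertex set $[n]$ is partitioned into $k$ communities $P_1,\dots,P_k$ with $\lfloor n/k\rfloor\le|P_i|\le\lceil n/k\rceil$ (the planted partition $\mathcal{P}$); independently for each pair of vertices, an edge is present with probability $p$ if both are in the same community and with probability $q$ otherwise. $k$ is fixed, $n\to\infty$, and $\omega=\omega(n)$ may depend on $n$. All partitions considered for the chain are partitions of $[n]$ into $k$ parts (possibly empty). Distance of two such partitions $\mathcal{A}=(A_i)_{i=1}^k$,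 $\mathcal{B}=(B_i)_{i=1}^k$: $d(\mathcal{A},\mathcal{B})=1-\frac1n\max_\sigma\sum_{i=1}^k|A_{\sigma(i)}\cap B_i|$, the maximum being over all permutations $\sigma$ of $[k]$. The chain with inverse temperature $\beta$ for a given graph $G$: from a partition $\mathcal{A}$ it moves to a partition $\mathcal{A}'$ with $d(\mathcal{A},\mathcal{A}')=1/n$ with probability $$\mathbb{P}(\mathcal{A}\to\mathcal{A}')=\frac{\exp(\beta n\,q_{\mathcal{A}'}(G))}{\sum_{\mathcal{B}:\,d(\mathcal{A},\mathcal{B})=1/n}\exp(\beta n\,q_{\mathcal{B}}(G))}.$$ The Gibbs distribution is $\mathbb{P}_{\rm Gibbs}(\mathcal{A})=\exp(\beta n\,q_{\mathcal{A}}(G))/Z$ with $Z=\sum_{\mathcal{B}}\exp(\beta n\,q_{\mathcal{B}}(G))$, the sum being over all $k$-partitions $\mathcal{B}$ of $[n]$. *)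

(* Defs.v *)
From HB Require Import structures.
From mathcomp Require Import all_boot all_order all_algebra all_fingroup.
Set Implicit Arguments.
Unset Strict Implicit.
Unset Printing Implicit Defensive.
Import Order.TTheory GRing.Theory Num.Theory.
Local Open Scope ring_scope.

(* A simple graph on [n], given by its edge set. *)
Definition sgraph (n : nat) : Type :=
  {E : {set {set 'I_n}} | [forall e in E, #|e| == 2%N]}.

HB.instance Definition _ (n : nat) := Finite.on (sgraph n).

Definition edges_in n (G : sgraph n) (A : {set 'I_n}) : nat :=
  #|[set e in val G | e \subset A]|.

Definition degree n (G : sgraph n) (v : 'I_n) : nat :=
  #|[set e in val G | v \in e]|.

Definition vol n (G : sgraph n) (A : {set 'I_n}) : nat :=
  (\sum_(v in A) degree G v)%N.

(* On an edgeless graph, where modularity is left undefined, this is 0. *)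
Definition modularity (R : fieldType) n (G : sgraph n)
    (A : {set {set 'I_n}}) : R :=
  \sum_(B in A) (edges_in G B)%:R / #|val G|%:R
  - \sum_(B in A) ((vol G B)%:R / (vol G [set: 'I_n])%:R) ^+ 2.

(* Partitions of [n] into k unlabelled, possibly empty parts.  The blocks of
   a MathComp partition are nonempty, so such a partition is one with at most
   k blocks, the other parts being empty. *)
Definition kpart (n k : nat) : Type :=
  {A : {set {set 'I_n}} | partition A [set: 'I_n] && (#|A| <= k)%N}.

HB.instance Definition _ (n k : nat) := Finite.on (kpart n k).

(* The parts A_0, ..., A_(k-1): the blocks in some order, padded with the empty
   set.  [dist] and [balanced] do not depend on the order. *)
Definition part n k (A : kpart n k) (i : 'I_k) : {set 'I_n} :=
  nth set0 (enum (val A)) i.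

Definition dist (R : fieldType) n k (A B : kpart n k) : R :=
  1 - (\max_(s : 'S_k) \sum_(i < k) #|part A (s i) :&: part B i|)%N%:R / n%:R.

(* (n + k.-1) %/ k is the ceiling of n / k. *)
Definition balanced n k (P : kpart n k) : Prop :=
  forall i : 'I_k, (n %/ k <= #|part P i| <= (n + k.-1) %/ k)%N.

Definition edge_prob (R : fieldType) n k (P : kpart n k) (p q : R)
    (e : {set 'I_n}) : R :=
  if [exists B in val P, e \subset B] then p else q.

Definition sbm_weight (R : fieldType) n k (P : kpart n k) (p q : R)
    (G : sgraph n) : R :=
  \prod_(e : {set 'I_n} | #|e| == 2%N)
    (if e \in val G then edge_prob P p q e else 1 - edge_prob P p q e).

From mathcomp Require Import all_classical all_reals all_analysis.
Local Open Scope classical_set_scope.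

Definition sbm_prob (R : realType) n k (P : kpart n k) (p q : R)
    (E : sgraph n -> Prop) : R :=
  \sum_(G : sgraph n | `[< E G >]) sbm_weight P p q G.

(* omega(n) > c and p = omega a / n is at most 1 (hence so is q, as b < a); both
   only for large n, as they are incompatible when n <= a c. *)
Definition admissible (R : realType) (a c : R) (omega : nat -> R) : Prop :=
  \forall n \near \oo, c < omega n /\ omega n * a / n%:R <= 1.

(* The maximum over all partitions of [n], with any number of parts. *)
Definition qstar (R : realType) n (G : sgraph n) : \bar R :=
  \big[maxe/-oo%E]_(A : {set {set 'I_n}} | finset.partition A finset.setT)
    (modularity R G A)%:E.

Definition E_close (R : realType) n k (P : kpart n k) (nu1 : R) :
    pred (kpart n k) :=
  fun A => dist R P A <= nu1.

Definition E_far (R : realType) n k (P : kpart n k) (nu2 : R) :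
    pred (kpart n k) :=
  fun A => nu2 <= dist R P A.

Definition E_btw (R : realType) n k (P : kpart n k) (nu1 nu2 : R) :
    pred (kpart n k) :=
  fun A => nu1 < dist R P A < nu2.

Definition kmodularity (R : realType) n k (G : sgraph n) (A : kpart n k) : R :=
  modularity R G (val A).

(* The maxima are in \bar R, so that the maximum over the empty set is -oo. *)
Definition overlap_gap (R : realType) n k (P : kpart n k)
    (nu1 nu2 c1 c2 : R) (G : sgraph n) : Prop :=
  [/\ forall A : kpart n k,
        (forall B : kpart n k, kmodularity R G B <= kmodularity R G A) ->
        E_close P nu1 A,
      (qstar R G - c1%:E <=
        \big[maxe/-oo]_(A : kpart n k | E_far P nu2 A)
          (kmodularity R G A)%:E)%E
    & (\big[maxe/-oo]_(A : kpart n k | E_btw P nu1 nu2 A)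
          (kmodularity R G A)%:E <=
        qstar R G - c1%:E - c2%:E)%E].

Definition boltzmann (R : realType) n k (G : sgraph n) (beta : R)
    (A : kpart n k) : R :=
  expR (beta * n%:R * kmodularity R G A).

Definition gibbs (R : realType) n k (G : sgraph n) (beta : R)
    (A : kpart n k) : R :=
  boltzmann G beta A / \sum_(B : kpart n k) boltzmann G beta B.

Definition transition (R : realType) n k (G : sgraph n) (beta : R)
    (A A' : kpart n k) : R :=
  if dist R A A' == 1 / n%:R then
    boltzmann G beta A' /
      \sum_(B : kpart n k | dist R A B == 1 / n%:R) boltzmann G beta B
  else 0.

Definition initial (R : realType) n k (G : sgraph n) (beta : R)
    (P : kpart n k) (nu2 : R) (A : kpart n k) : R :=
  if E_far P nu2 A then
    gibbs G beta A / \sum_(B : kpart n k | E_far P nu2 B) gibbs G beta B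
  else 0.

(* (X_t) is a Markov chain on the finite state space S, with initial
   distribution mu0 and transition matrix K.  The Markov property is written
   multiplicatively, to avoid conditioning on null events. *)
Definition markov_chain (R : realType) (S : finType) (mu0 : S -> R)
    (K : S -> S -> R) (d : measure_display) (T : measurableType d)
    (Pr : probability T R) (X : nat -> T -> S) : Prop :=
  [/\ forall t s, measurable [set w | X t w = s],
      forall s, Pr [set w | X 0%N w = s] = (mu0 s)%:E
    & forall (t : nat) (x : nat -> S),
        Pr [set w | forall i, (i <= t.+1)%N -> X i w = x i] =
        (Pr [set w | forall i, (i <= t)%N -> X i w = x i] *
          (K (x t) (x t.+1))%:E)%E].

(* min {t : X_t \in D}, which is +oo if D is never hit. *)
Definition hitting_time (R : realType) (S T : Type) (X : nat -> T -> S)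
    (D : pred S) (w : T) : \bar R :=
  ereal_inf [set (t%:R)%:E | t in [set t : nat | D (X t w)]].

(* P(tau >= s) >= r.  This probability is determined by the law of the chain,
   so it is asserted for every realization of the chain. *)
Definition hitting_prob_ge (R : realType) n k (P : kpart n k)
    (nu1 nu2 beta s r : R) (G : sgraph n) : Prop :=
  forall (d : measure_display) (T : measurableType d) (Pr : probability T R)
      (X : nat -> T -> kpart n k),
    markov_chain (initial G beta P nu2) (transition G beta) Pr X ->
    (r%:E <= Pr [set w | s%:E <= hitting_time R X (E_close P nu1) w])%E.

(* Main.v *)
Require Import Defs.
From mathcomp Require Import all_boot all_order all_algebra all_fingroup.
From mathcomp Require Import ring lra.
Set Implicit Arguments.
Unset Strict Implicit.
Unset Printing Implicit Defensive.
Import Order.TTheory GRing.Theory Num.Theory.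
Local Open Scope ring_scope.

(** The bound holds for every graph with the overlap gap property, as soon as
[n] exceeds a threshold that does not depend on the graph; the probability over
the graph is then inherited from the hypothesis by monotonicity.

Fix such a graph, and write [w A] for the Boltzmann weight of [A] and [W A] for
the total weight of the neighbours of [A].  As [dist] is symmetric, the chain is
reversible with respect to [w A * W A], and not with respect to the Gibbs
weights: the flow from [A] to a neighbour [B] is [w A * w B].  One step changes
the distance to the planted partition by at most [1 / n] ([dist_triangle]), so a
chain started in the far region must step from a far partition into the gap
before it can hit the close region.

If the start is restricted to far partitions whose neighbourhood weight is at
least [rho], the initial distribution is at most [w A * W A / (rho * wfar)],
where [wfar] is the total weight of the far region.  This domination is
preserved by the chain ([occupation_bound]), hence at each time the probability
of leaving the far region is at most the sum of [w A * w B / (rho * wfar)] over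
far [A] and neighbours [B] in the gap, that is, at most the number of partitions
times [max w B / rho] ([flow_bound], [exit_bound]).  The factor [W A] of the
departure point cancels, which keeps the maximum degree of the graph out of the
bound.

For the lower bound [rho], moving a vertex of minimum degree changes the
modularity by [O(1 / n)] ([neighbour_exists]), so that [W A] is at
least a constant times [w A].  Restricting to far [A] of modularity at least
[q* - c1 - c2 / 2] costs little, because the other far partitions have
exponentially small Gibbs weight relative to [wfar] ([start_bound]).  There are
at most [k ^ n] partitions, which is absorbed by the gain [beta * c2 * n / 2] in
the exponent once [beta * c2 >= 2 * (ln k + 2)]; a union bound over the first
[exp n] steps concludes ([slow_hitting]). *)

(** * Parts and labellings of a partition *)

(** Both families list the same nonempty sets without repetition, hence, having
the same length, they also contain equally many empty sets. *)
Lemma matching_families (T : finType) (k : nat) (g h : 'I_k -> {set T}) :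
  (forall i j, g i != set0 -> g i = g j -> i = j) ->
  (forall i j, h i != set0 -> h i = h j -> i = j) ->
  (forall X, X != set0 ->
     (X \in [set g i | i : 'I_k]) = (X \in [set h i | i : 'I_k])) ->
  exists s : 'S_k, forall i, g (s i) = h i.
Proof.
move=> g_inj h_inj gh.
pose ne (X : {set T}) := X != set0.
pose L (u : 'I_k -> {set T}) := [seq u i | i <- enum 'I_k].
have uniqL u : (forall i j, u i != set0 -> u i = u j -> i = j) ->
    uniq [seq X <- L u | ne X].
  move=> u_inj; rewrite filter_map map_inj_in_uniq; first exact/filter_uniq/enum_uniq.
  by move=> i j; rewrite mem_filter => /andP[/= i0 _] _; apply: u_inj.
have memL u X : (X \in L u) = (X \in [set u i | i : 'I_k]).
  apply/mapP/imsetP => -[i _ ->]; exists i => //; exact: mem_enum.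
have emptyL u : [seq X <- L u | predC ne X]
    = nseq (size [seq X <- L u | predC ne X]) set0.
  apply/all_pred1P/allP => X; rewrite mem_filter => /andP[/=].
  by rewrite /ne negbK.
have p1 : perm_eq [seq X <- L g | ne X] [seq X <- L h | ne X].
  apply: uniq_perm; rewrite ?uniqL // => X; rewrite !mem_filter !memL.
  by case: (boolP (ne X)) => //= /gh.
have pL : perm_eq (L h) [tuple g i | i < k].
  change (perm_eq (L h) (L g)).
  have pC u := perm_filterC ne (L u).
  rewrite perm_sym -(pC g) perm_sym -(pC h) perm_sym.
  apply: perm_cat => //; rewrite (emptyL g) (emptyL h).
  suff -> : size [seq X <- L g | predC ne X] = size [seq X <- L h | predC ne X]
    by [].
  have := perm_size p1; rewrite !size_filter.
  have := count_predC ne (L g); have := count_predC ne (L h).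
  rewrite !size_map => <- /[swap] ->; exact: addnI.
have [s e] := tuple_permP pL; exists s => i.
have := congr1 (fun l => nth set0 l i) e.
rewrite (nth_map i) ?size_enum_ord // nth_ord_enum => ->.
rewrite -[RHS](tnth_nth set0 _ i) !tnth_mktuple //.
Qed.

Section Parts.
Variables (n k : nat).
Implicit Types (A B C : kpart n k) (f : 'I_n -> 'I_k).

Lemma part_mem A (i : 'I_k) : (i < #|val A|)%N -> part A i \in val A.
Proof. by move=> lt_i; rewrite -mem_enum /part mem_nth // -cardE. Qed.

Lemma part_default A (i : 'I_k) : (#|val A| <= i)%N -> part A i = set0.
Proof. by move=> le_i; rewrite /part nth_default // -cardE. Qed.

Lemma mem_part A (X : {set 'I_n}) :
  X \in val A -> exists i : 'I_k, part A i = X.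
Proof.
move=> XA; have /andP[_ lek] := valP A.
have lti : (index X (enum (val A)) < k)%N.
  by apply: leq_trans lek; rewrite cardE index_mem mem_enum.
by exists (Ordinal lti); rewrite /part /= nth_index // mem_enum.
Qed.

Lemma part_inj_mem A (i j : 'I_k) v :
  v \in part A i -> v \in part A j -> i = j.
Proof.
have /andP[/and3P[_ tI _] _] := valP A.
case: (ltnP i #|val A|) => [lti|/part_default->]; last by rewrite inE.
case: (ltnP j #|val A|) => [ltj|/part_default->]; last by rewrite inE.
move=> vi vj; apply/val_inj/eqP.
rewrite -(nth_uniq set0 _ _ (enum_uniq (val A))) -?cardE //; apply/eqP.
rewrite -[LHS](def_pblock tI (part_mem lti) vi).
exact: (def_pblock tI (part_mem ltj) vj).
Qed.

Definition fiber f (i : 'I_k) : {set 'I_n} := [set v | f v == i].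

(** The parts themselves are the fibers, with no permutation needed. *)
Lemma kpart_labelling A : exists f, forall i, part A i = fiber f i.
Proof.
have /fin_all_exists[f fP] : forall v, exists i : 'I_k, v \in part A i.
  move=> v; have /andP[/and3P[/eqP cA _ _] _] := valP A.
  have: v \in cover (val A) by rewrite cA inE.
  by case/bigcupP=> X /mem_part[i <-] vX; exists i.
exists f => i; apply/setP=> v; rewrite inE; apply/idP/eqP => [vi|<- //].
exact: part_inj_mem (fP v) vi.
Qed.

Lemma val_part A : val A = [set part A i | i : 'I_k] :\ set0.
Proof.
have /andP[/and3P[_ _ n0] _] := valP A.
apply/setP=> X; rewrite !inE; apply/idP/andP => [XA|[Xn0 /imsetP[i _ eX]]].
  split; first by apply: contraNneq n0 => <-.
  by have [i <-] := mem_part XA; apply: imset_f.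
case: (ltnP i #|val A|) => [/part_mem|/part_default e0]; first by rewrite -eX.
by rewrite eX e0 eqxx in Xn0.
Qed.

Lemma eq_kpart A B : (forall i, exists j, part A i = part B j) ->
  (forall j, exists i, part A i = part B j) -> A = B.
Proof.
move=> AB BA; apply/val_inj; rewrite /= !val_part; congr (_ :\ _).
apply/setP=> X; apply/imsetP/imsetP => -[i _ ->].
  by have [j ->] := AB i; exists j.
by have [j <-] := BA i; exists j.
Qed.

(** Conversely, the parts of the partition into the fibers of a labelling come in
the order of an enumeration, and match the labels only up to a permutation. *)
Lemma kpart_of_labelling f :
  exists A, exists s : 'S_k, forall i, part A (s i) = fiber f i.
Proof.
pose V := [set fiber f i | i : 'I_k] :\ set0.
have VP : partition V [set: 'I_n] && (#|V| <= k)%N.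
  apply/andP; split; last first.
    apply: leq_trans (subset_leq_card (subsetDl _ _)) _.
    by apply: leq_trans (leq_imset_card _ _) _; rewrite card_ord.
  apply/and3P; split; last by rewrite !inE eqxx.
    rewrite eqEsubset subsetT; apply/subsetP=> v _; apply/bigcupP.
    have vf : v \in fiber f (f v) by rewrite inE.
    exists (fiber f (f v)) => //; rewrite !inE imset_f // andbT.
    by apply/set0Pn; exists v.
  apply/trivIsetP=> X Y /setD1P[_ /imsetP[i _ ->]] /setD1P[_ /imsetP[j _ ->]] ne.
  apply/pred0P=> v /=; rewrite !inE; apply/negP=> /andP[/eqP ei /eqP ej].
  by rewrite -ei -ej eqxx in ne.
pose A : kpart n k := exist _ V VP; exists A.
have [s sP] : exists s : 'S_k, forall i, part A (s i) = fiber f i.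
  apply: matching_families => [i j /set0Pn[v vi] e|i j /set0Pn[v vi] e|X Xn0].
  - by apply: (part_inj_mem vi); rewrite -e.
  - by move: (vi); rewrite e; move: vi; rewrite !inE => /eqP-> /eqP.
  by have := erefl (X \in val A); rewrite {1}val_part !inE Xn0 /= => ->.
by exists s.
Qed.

(** The padding by empty parts does not contribute. *)
Lemma sum_blocks (R : nmodType) (F : {set 'I_n} -> R) A :
  F set0 = 0 -> \sum_(B in val A) F B = \sum_(i < k) F (part A i).
Proof.
move=> F0; rewrite [RHS](bigID (fun i => part A i == set0)) /=.
rewrite [X in _ = X + _]big1 ?add0r => [|i /eqP-> //].
rewrite (eq_bigl (mem [set part A i | i in [pred i | part A i != set0]])).
  rewrite big_imset //= => i j; rewrite !inE => /set0Pn[v vi] _ e.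
  by apply: (part_inj_mem vi); rewrite -e.
move=> X /=; rewrite val_part !inE; apply/andP/imsetP.
  by case=> X0 /imsetP[i _ eX]; exists i; rewrite // inE -eX.
by case=> i i0 ->; rewrite imset_f //; split.
Qed.

Lemma sum_card_part A : (\sum_(i < k) #|part A i| = n)%N.
Proof.
have /andP[/card_partition + _] := valP A; rewrite cardsT card_ord => e.
rewrite [RHS]e; apply/esym.
by rewrite (@sum_blocks nat (fun B : {set 'I_n} => #|B|)) ?cards0.
Qed.

End Parts.

(** * The distance of partitions *)

Section Overlap.
Variables (n k : nat).
Implicit Types A B C : kpart n k.

(** The maximum in [dist], so that [dist] is [1 - overlap / n]. *)
Definition overlap A B : nat :=
  \max_(s : 'S_k) \sum_(i < k) #|part A (s i) :&: part B i|.

Lemma overlap_le A B : (overlap A B <= n)%N.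
Proof.
apply/bigmax_leqP=> s _; rewrite -[leqRHS](sum_card_part B).
by apply: leq_sum => i _; rewrite subset_leq_card ?subsetIr.
Qed.

Lemma overlap_attained A B :
  exists s : 'S_k, overlap A B = \sum_(i < k) #|part A (s i) :&: part B i|.
Proof.
have [|s e] := @bigop.eq_bigmax _ (fun s : 'S_k =>
  \sum_(i < k) #|part A (s i) :&: part B i|)%N; last by exists s.
by apply/card_gt0P; exists 1%g.
Qed.

Lemma overlap_ge A B (s : 'S_k) :
  (\sum_(i < k) #|part A (s i) :&: part B i| <= overlap A B)%N.
Proof. exact: (leq_bigmax s). Qed.

Lemma overlap_symle A B : (overlap A B <= overlap B A)%N.
Proof.
have [s ->] := overlap_attained A B.
apply: leq_trans (overlap_ge B A s^-1); rewrite (reindex_perm s^-1)%g /=.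
by apply: leq_sum => i _; rewrite permKV setIC.
Qed.

Lemma overlap_sym A B : overlap A B = overlap B A.
Proof. by apply/eqP; rewrite eqn_leq !overlap_symle. Qed.

(** A matching of the parts of [A] with those of [B] composes with one of [B] with
[C]; on each part of [B], inclusion-exclusion bounds what is lost. *)
Lemma overlap_triangle A B C :
  (overlap A B + overlap B C <= overlap A C + n)%N.
Proof.
have [s ->] := overlap_attained A B; have [t ->] := overlap_attained B C.
rewrite (reindex_perm t) /= -big_split /= -[X in (_ <= _ + X)%N](sum_card_part B).
rewrite [X in (_ <= _ + X)%N](reindex_perm t) /=.
apply: (@leq_trans (\sum_(i < k) #|part A ((t * s)%g i) :&: part C i|
  + \sum_(i < k) #|part B (t i)|)%N); last by rewrite leq_add2r overlap_ge.
rewrite -big_split /=; apply: leq_sum => i _; rewrite permM.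
set X := part A _; set Y := part B _; set Z := part C _.
rewrite -cardsUI addnC; apply: leq_add.
  apply: subset_leq_card; apply/subsetP=> v; rewrite !inE.
  by case/andP=> /andP[-> _] /andP[_ ->].
by rewrite subset_leq_card // subUset subsetIr subsetIl.
Qed.

(** A full overlap forces equality in each of the inclusions of [X :&: Y] in the
matched parts [X] and [Y]. *)
Lemma overlap_max A B : overlap A B = n -> A = B.
Proof.
have [s ->] := overlap_attained A B => e.
have subA i (_ : predT i) := subset_leqif_card (subsetIl (part A (s i)) (part B i)).
have subB i (_ : predT i) := subset_leqif_card (subsetIr (part A (s i)) (part B i)).
have [_] := leqif_sum subA; have [_] := leqif_sum subB.
have eA : \sum_(i < k) #|part A (s i)| = n.
  by rewrite -[RHS](sum_card_part A) [RHS](reindex_perm s).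
rewrite e sum_card_part eA eqxx.
move=> /esym/forallP B_sub /esym/forallP A_sub.
have AB i : part A (s i) = part B i.
  apply/eqP; rewrite eqEsubset.
  rewrite (subset_trans (A_sub i) (subsetIr _ _)).
  exact: subset_trans (B_sub i) (subsetIl _ _).
apply: eq_kpart => i; last by exists (s i).
by exists (s^-1 i)%g; rewrite -AB permKV.
Qed.

End Overlap.

Section Dist.
Variables (R : realFieldType) (n k : nat).
Implicit Types A B C : kpart n k.
Hypothesis n_gt0 : (0 < n)%N.

Lemma distE A B : dist R A B = 1 - (overlap A B)%:R / n%:R.
Proof. by []. Qed.

Lemma dist_sym A B : dist R A B = dist R B A.
Proof. by rewrite !distE overlap_sym. Qed.

Lemma dist_triangle A B C : dist R A C <= dist R A B + dist R B C.
Proof.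
have n0 : 0 < n%:R :> R by rewrite ltr0n.
have := overlap_triangle A B C; rewrite -(ler_nat R) !natrD => h.
rewrite !distE -subr_ge0.
have -> : 1 - (overlap A B)%:R / n%:R + (1 - (overlap B C)%:R / n%:R)
   - (1 - (overlap A C)%:R / n%:R)
   = ((overlap A C)%:R + n%:R - ((overlap A B)%:R + (overlap B C)%:R)) / n%:R :> R.
  by field; rewrite lt0r_neq0.
by rewrite divr_ge0 ?subr_ge0 // ltW.
Qed.

Lemma dist_eq_step A B :
  overlap A B = n.-1 -> dist R A B = 1 / n%:R.
Proof.
rewrite distE => ->; case: n n_gt0 => // m _ /=.
by rewrite -(natr1 m); field; rewrite natr1 pnatr_eq0.
Qed.
End Dist.

(** The labels themselves provide a matching of the parts. *)
Lemma overlap_fibers n k (f g : 'I_n -> 'I_k) (A B : kpart n k) (s t : 'S_k) :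
  (forall i, part A (s i) = fiber f i) -> (forall i, part B (t i) = fiber g i) ->
  (#|[set v | f v == g v]| <= overlap A B)%N.
Proof.
move=> fA gB; apply: leq_trans (overlap_ge A B (t^-1 * s)%g).
rewrite (reindex_perm t) /= -sum1_card (partition_big g xpredT) //=.
apply: leq_sum => i _; rewrite permM permK fA gB -sum1_card.
rewrite leq_eqVlt; apply/orP; left; apply/eqP; apply: eq_bigl => v.
by rewrite !inE; case: (eqVneq (g v) i) => [->|_]; rewrite ?andbT ?andbF.
Qed.

Lemma fiber_labels n k (f g : 'I_n -> 'I_k) (A : kpart n k) (t : 'S_k) :
  (forall i, part A i = fiber f i) -> (forall i, part A (t i) = fiber g i) ->
  forall v, f v = t (g v).
Proof.
move=> fA gA v; apply: (@part_inj_mem _ _ A _ _ v).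
  by rewrite fA inE.
by rewrite gA inE.
Qed.

(** * Modularity under the move of one vertex *)

Section Modularity.
Variables (n : nat) (G : sgraph n).

Lemma edges_in0 : edges_in G set0 = 0%N.
Proof.
apply/eqP; rewrite cards_eq0; apply/eqP/setP=> e; rewrite !inE subset0.
apply/negP=> /andP[eG /eqP e0]; have /forall_inP/(_ e eG) := valP G.
by rewrite e0 cards0.
Qed.

Lemma vol0 : vol G set0 = 0%N.
Proof. by rewrite /vol big_set0. Qed.

Lemma vol_subset (X Y : {set 'I_n}) : X \subset Y -> (vol G X <= vol G Y)%N.
Proof.
move=> XY; rewrite /vol [leqRHS](big_setID X) /= (setIidPr XY).
exact: leq_addr.
Qed.

Lemma handshake : vol G [set: 'I_n] = (2 * #|val G|)%N.
Proof.
rewrite /vol /degree.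
under eq_bigr do rewrite -sum1_card.
rewrite (exchange_big_dep (mem (val G))) /=; last first.
  by move=> v e _; rewrite inE => /andP[].
rewrite mulnC -sum_nat_const; apply: eq_bigr => e eG.
have /forall_inP/(_ e eG)/eqP card_e := valP G.
by rewrite -[RHS]card_e -sum1_card; apply: eq_bigl => v; rewrite !inE eG.
Qed.

(** The average degree is [2m / n]. *)
Lemma min_degree : (0 < n)%N -> exists v, (degree G v * n <= 2 * #|val G|)%N.
Proof.
move=> n_gt0; apply/existsP; apply: contraT => /existsPn heavy.
have : (\sum_(v < n) (2 * #|val G|).+1 <= \sum_(v < n) degree G v * n)%N.
  by apply: leq_sum => v _; rewrite ltnNge heavy.
rewrite sum_nat_const card_ord -big_distrl /= mulnC leq_pmul2r //.
have -> : \sum_(v < n) degree G v = (2 * #|val G|)%N.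
  by rewrite -handshake; apply: eq_bigl => v; rewrite inE.
by rewrite ltnn.
Qed.

Lemma modularity_parts (R : fieldType) k (A : kpart n k) :
  modularity R G (val A)
  = \sum_(i < k) ((edges_in G (part A i))%:R / #|val G|%:R
      - ((vol G (part A i))%:R / (vol G [set: 'I_n])%:R) ^+ 2).
Proof.
rewrite /modularity !sum_blocks ?sumrB // ?edges_in0 ?vol0 mul0r //.
by rewrite expr0n.
Qed.

Variables (R : realFieldType) (k : nat) (f : 'I_n -> 'I_k) (v : 'I_n) (j : 'I_k).
Let g w := if w == v then j else f w.

(** Only edges at [v] can be lost, and only from the part that [v] leaves. *)
Lemma edges_in_relabel i :
  (edges_in G (fiber f i) <= edges_in G (fiber g i) + (i == f v) * degree G v)%N.
Proof.
rewrite /edges_in /degree; set E := [set e in val G | _ \subset fiber g i].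
apply: (@leq_trans #|E :|: (if i == f v then [set e in val G | v \in e] else set0)|).
  apply/subset_leq_card/subsetP=> e; rewrite !inE => /andP[eG /subsetP ef].
  have [ve|ve] := boolP (v \in e).
    by have:= ef v ve; rewrite inE eq_sym => ->; rewrite inE eG ve orbT.
  apply/orP; left; rewrite eG; apply/subsetP=> w we.
  have := ef w we; rewrite !inE /g; case: (eqVneq w v) => // ew.
  by rewrite -ew we in ve.
rewrite (leq_trans (leq_card_setU _ _)) // leq_add2l.
by case: eqP; rewrite ?cards0 ?mul1n.
Qed.

Lemma vol_relabel i :
  (vol G (fiber g i) <= vol G (fiber f i) + (i == j) * degree G v)%N.
Proof.
rewrite /vol (bigID (pred1 v)) /= addnC; apply: leq_add.
  rewrite [leqRHS](bigID (pred1 v)) /= addnC.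
  apply: leq_trans (leq_addr _ _).
  rewrite leq_eqVlt; apply/orP; left; apply/eqP; apply: eq_bigl => w.
  by rewrite !inE /g; case: (w == v); rewrite ?andbF.
have [->|ne] := eqVneq i j.
  rewrite mul1n (big_pred1 v) // => w; rewrite !inE /g /=.
  by case: (eqVneq w v); rewrite ?eqxx ?andbF.
rewrite big_pred0 // => w; rewrite !inE /g.
by case: (eqVneq w v); rewrite ?andbF // eq_sym (negbTE ne).
Qed.

(** Moving [v] loses at most [degree v / m] in the edge term.  In the volume term
only the part that [v] enters grows: a relative volume [x] at most [1] grows by
[d = degree v / (2 * m)], and [(x + d)^2 <= x^2 + 3 * d].  When [m = 0] all
quotients are [0] and the bounds persist. *)
Lemma modularity_relabel (A B : kpart n k) (t : 'S_k) :
  (degree G v * n <= 2 * #|val G|)%N ->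
  (forall i, part A i = fiber f i) -> (forall i, part B (t i) = fiber g i) ->
  modularity R G (val A) - 5 / n%:R <= modularity R G (val B).
Proof.
move=> small_v fA gB; rewrite !modularity_parts [leRHS](reindex_perm t) /=.
under eq_bigr do rewrite fA; under [leRHS]eq_bigr do rewrite gB.
set V : R := (vol G [set: 'I_n])%:R; set m : R := #|val G|%:R.
pose d : R := (degree G v)%:R.
have n_gt0 : 0 < n%:R :> R by rewrite ltr0n; case: (n) v => // -[].
have V_ge0 : 0 <= V by rewrite ler0n.
have m_ge0 : 0 <= m by rewrite ler0n.
have Vm : V = 2 * m by rewrite /V handshake natrM.
have dn : d * n%:R <= 2 * m by rewrite -!natrM ler_nat.
have d_m : d / m <= 2 / n%:R.
  have [m0|m0] := eqVneq m 0; first by rewrite m0 invr0 mulr0 divr_ge0 // ltW.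
  have mp : 0 < m by rewrite lt0r m0.
  by rewrite ler_pdivrMr // mulrAC ler_pdivlMr.
have d_V : d / V <= 1 / n%:R.
  have -> : 1 / n%:R = 2^-1 * (2 / n%:R) :> R by field; rewrite lt0r_neq0.
  by rewrite Vm invfM mulrCA ler_pM2l ?invr_gt0.
have d_V1 : d / V <= 1.
  apply: le_trans d_V _; rewrite ler_pdivrMr // mul1r ler1n.
  by move: n_gt0; rewrite ltr0n.
have d_V0 : 0 <= d / V by rewrite divr_ge0 ?ler0n.
have edge_loss i : (edges_in G (fiber f i))%:R / m
    <= (edges_in G (fiber g i))%:R / m + (i == f v)%:R * (d / m).
  rewrite mulrA -mulrDl ler_wpM2r ?invr_ge0 // -natrM -natrD ler_nat.
  exact: edges_in_relabel.
have vol_gain i : ((vol G (fiber g i))%:R / V) ^+ 2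
    <= ((vol G (fiber f i))%:R / V) ^+ 2 + (i == j)%:R * (3 * (d / V)).
  have : (vol G (fiber g i))%:R / V
      <= (vol G (fiber f i))%:R / V + (i == j)%:R * (d / V).
    rewrite mulrA -mulrDl ler_wpM2r ?invr_ge0 // -natrM -natrD ler_nat.
    exact: vol_relabel.
  have x0 : 0 <= (vol G (fiber g i))%:R / V by rewrite divr_ge0.
  have y0 : 0 <= (vol G (fiber f i))%:R / V by rewrite divr_ge0.
  have y1 : (vol G (fiber f i))%:R / V <= 1.
    have [V0|V0] := eqVneq V 0; first by rewrite V0 invr0 mulr0.
    rewrite ler_pdivrMr ?lt0r ?V0 // mul1r ler_nat.
    exact/vol_subset/subsetT.
  move: x0 y0 y1; move: (_ / V) (_ / V) => x y x0 y0 y1.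
  by case: eqP => _ /=; rewrite ?mul1r ?mul0r ?addr0; nra.
have one_f : \sum_(i < k) (i == f v)%:R = 1 :> R.
  by rewrite (bigD1 (f v)) //= eqxx big1 ?addr0 // => i /negbTE->.
have one_j : \sum_(i < k) (i == j)%:R = 1 :> R.
  by rewrite (bigD1 j) //= eqxx big1 ?addr0 // => i /negbTE->.
have edges_loss : \sum_(i < k) (edges_in G (fiber f i))%:R / m
    <= \sum_(i < k) ((edges_in G (fiber g i))%:R / m + (i == f v)%:R * (d / m)).
  by apply: ler_sum => i _; apply: edge_loss.
have vols_gain : \sum_(i < k) ((vol G (fiber g i))%:R / V) ^+ 2
    <= \sum_(i < k) (((vol G (fiber f i))%:R / V) ^+ 2
         + (i == j)%:R * (3 * (d / V))).
  by apply: ler_sum => i _; apply: vol_gain.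
have := edges_loss; have := vols_gain.
rewrite !big_split /= -!mulr_suml one_f one_j !sumrN.
have -> : 5 / n%:R = 2 / n%:R + 3 * (1 / n%:R) :> R by field; rewrite lt0r_neq0.
lra.
Qed.
End Modularity.

(** The vertex [v] of minimum degree must be moved to a part that changes the
unlabelled partition: to another nonempty part if there is one, and otherwise to
an empty one.  In both cases some [u] is together with [v] in exactly one of the
two partitions. *)
Lemma neighbour_exists (R : realFieldType) n k (G : sgraph n) (A : kpart n k) :
  (1 < n)%N -> (1 < k)%N ->
  exists B : kpart n k, dist R A B = 1 / n%:R /\
    modularity R G (val A) - 5 / n%:R <= modularity R G (val B).
Proof.
move=> n1 k1; have n_gt0 := ltnW n1.
have [v small_v] := min_degree G n_gt0.
have [f fA] := kpart_labelling A.
have [u [j sep]] : exists u, exists j, u != v /\ (f u == f v) != (f u == j).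
  have [/existsP[u fu]|] := boolP [exists u, f u != f v].
    exists u, (f u); rewrite eqxx (negbTE fu); split=> //.
    by apply: contraNneq fu => ->.
  rewrite negb_exists => /forallP same.
  have [u uv] : exists u, u != v.
    have : (0 < #|predC1 v|)%N by rewrite cardC1 card_ord -subn1 subn_gt0.
    by case/card_gt0P=> u; exists u.
  have [j jv] : exists j, j != f v.
    have : (0 < #|predC1 (f v)|)%N by rewrite cardC1 card_ord -subn1 subn_gt0.
    by case/card_gt0P=> j; exists j.
  exists u, j; have := same u; rewrite negbK => /eqP ->.
  by rewrite eqxx [f v == j]eq_sym (negbTE jv).
have [uv {}sep] := sep.
pose g w := if w == v then j else f w.
have [B [t gB]] := kpart_of_labelling g.
exists B; split; last exact: modularity_relabel small_v fA gB.
apply: dist_eq_step => //; apply/eqP; rewrite eqn_leq; apply/andP; split.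
  rewrite -ltnS prednK // ltn_neqAle overlap_le andbT.
  apply: contra sep => /eqP/overlap_max AB; rewrite -AB in gB.
  have lab := fiber_labels fA gB.
  by rewrite {1}(lab u) (lab v) (inj_eq perm_inj) /g eqxx (negbTE uv).
have fA1 i : part A ((1 : 'S_k)%g i) = fiber f i by rewrite perm1.
apply: leq_trans (overlap_fibers fA1 gB).
have <- : #|[set~ v]| = n.-1 by rewrite cardsC1 card_ord.
by apply/subset_leq_card/subsetP=> w; rewrite !inE /g => /negbTE->.
Qed.

Lemma card_kpart n k : (#|{: kpart n k}| <= k ^ n)%N.
Proof.
have /fin_all_exists[lab labP] : forall A : kpart n k,
    exists f : {ffun 'I_n -> 'I_k}, forall i, part A i = fiber f i.
  move=> A; have [f fA] := kpart_labelling A; exists [ffun v => f v] => i.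
  by rewrite fA; apply/setP=> v; rewrite !inE ffunE.
rewrite -[X in (_ <= X ^ _)%N]card_ord -[X in (_ <= _ ^ X)%N]card_ord -card_ffun.
apply: (leq_card lab) => A B e.
by apply: eq_kpart => i; exists i; rewrite !labP e.
Qed.

From mathcomp Require Import all_classical all_reals all_analysis.
Local Open Scope classical_set_scope.
Local Open Scope ring_scope.

(** * Finite Markov chains as families of random variables *)

Section FiniteValued.
Context (R : realType) (d : measure_display) (T : measurableType d).
Context (Pr : probability T R) (F : finType) (Y : T -> F).
Hypothesis mY : forall y, measurable [set w | Y w = y].

Lemma measurable_finite_event (Q : pred F) : measurable [set w | Q (Y w)].
Proof.
have -> : [set w | Q (Y w)] = \bigcup_(y in [set y | Q y]) [set w | Y w = y].
  by apply/seteqP; split=> [w Qw|w [y /= Qy eY]] /=; [exists (Y w)|rewrite eY].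
by apply: fin_bigcup_measurable.
Qed.

Lemma total_probability (E : set T) : measurable E ->
  Pr E = (\sum_(y : F) Pr (E `&` [set w | Y w = y]))%E.
Proof.
move=> mE; have {1}-> : E = \bigcup_(y in [set` enum F]) (E `&` [set w | Y w = y]).
  apply/seteqP; split=> [w Ew|w [y _ [Ew _]] //].
  by exists (Y w) => //=; exact: mem_enum.
rewrite measure_fin_bigcup //.
- by rewrite -fsbig_seq ?enum_uniq // big_enum.
- by move=> y z _ _ [w [[_ /= <-] [_ /= <-]]].
- by move=> y _; apply: measurableI.
Qed.

End FiniteValued.

Section Chain.
Context (R : realType) (S : finType) (mu0 : S -> R) (K : S -> S -> R).
Context (d : measure_display) (T : measurableType d) (Pr : probability T R).
Context (X : nat -> T -> S).
Hypothesis chain : markov_chain mu0 K Pr X.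
Variable D : pred S.

Let start : set T := [set w | D (X 0%N w)].
Let at_ t A : set T := [set w | X t w = A].

Lemma measurable_at t A : measurable (at_ t A).
Proof. by case: chain => mX _ _; apply: mX. Qed.

Lemma measurable_start : measurable start.
Proof. apply: (measurable_finite_event (Y := X 0%N)) => A; exact: measurable_at. Qed.

(** The Markov property is given for whole paths only. *)
Definition path_to t (w : T) : {ffun 'I_t.+1 -> S} := [ffun i : 'I_t.+1 => X i w].

Lemma path_toE t x : [set w | path_to t w = x] =
  [set w | forall i, (i <= t)%N -> X i w = x (inord i)].
Proof.
apply/seteqP; split=> [w /= <- i it|w /= h].
  by rewrite ffunE inordK.
by apply/ffunP=> i; rewrite ffunE h ?inord_val // -ltnS.
Qed.

Lemma measurable_path t x : measurable [set w | path_to t w = x].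
Proof.
rewrite path_toE.
have -> : [set w | forall i, (i <= t)%N -> X i w = x (inord i)] =
    \bigcap_(i in [set i | (i <= t)%N]) at_ i (x (inord i)) by [].
by apply: bigcap_measurableType => i _; apply: measurable_at.
Qed.

(** This is the Markov property for the path that follows [x] and then goes to
[B]. *)
Lemma path_step t x B :
  Pr ([set w | path_to t w = x] `&` at_ t.+1 B) =
  (Pr [set w | path_to t w = x] * (K (x ord_max) B)%:E)%E.
Proof.
case: chain => _ _ step.
pose z i := if (i <= t)%N then x (inord i) else B.
have := step t z; rewrite {3 4}/z leqnn ltnn.
have -> : [set w | forall i, (i <= t)%N -> X i w = z i] = [set w | path_to t w = x].
  by rewrite path_toE; apply/seteqP; split=> w h i it; have := h i it; rewrite /z it.
have -> : [set w | forall i, (i <= t.+1)%N -> X i w = z i]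
    = [set w | path_to t w = x] `&` at_ t.+1 B.
  rewrite path_toE; apply/seteqP; split=> [w h|w [h e] i] /=.
    split=> [i it|]; first by rewrite h ?(leqW it) // /z it.
    by rewrite /at_ /= h // /z ltnn.
  by rewrite leq_eqVlt => /orP[/eqP->|it]; rewrite /z ?ltnn //= -ltnS it h.
move=> ->; congr (_ * (K _ _)%:E)%E; congr (x _).
by apply/val_inj; rewrite /= inordK.
Qed.

(** Decompose along the path up to time [t]: each path either lies in the
conditioning event or is disjoint from it. *)
Lemma flow t A B : Pr (start `&` at_ t A `&` at_ t.+1 B) =
  (Pr (start `&` at_ t A) * (K A B)%:E)%E.
Proof.
have mSA : measurable (start `&` at_ t A).
  by apply: measurableI; [exact: measurable_start|exact: measurable_at].
rewrite (total_probability (Y := path_to t) Pr); last 2 first.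
- exact: measurable_path.
- by apply: measurableI => //; exact: measurable_at.
rewrite (total_probability (Y := path_to t) Pr (@measurable_path t) mSA).
rewrite ge0_sume_distrl; last by move=> x _; apply: measure_ge0.
apply: eq_bigr => x _.
have [good|bad] := boolP (D (x ord0) && (x ord_max == A)).
  have sub : [set w | path_to t w = x] `<=` start `&` at_ t A.
    by move=> w /= e; case/andP: good => + /eqP; rewrite -e !ffunE.
  rewrite setIAC (setIidr sub) path_step.
  by case/andP: good => _ /eqP ->.
have disj : start `&` at_ t A `&` [set w | path_to t w = x] = set0.
  rewrite -subset0 => w [[Dw /= wA] /= e]; case/negP: bad.
  by rewrite -e !ffunE; apply/andP; split; [exact: Dw|exact/eqP].
by rewrite setIAC disj set0I measure0 mul0e.
Qed.

Lemma measurable_start_at t A : measurable (start `&` at_ t A).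
Proof. by apply: measurableI; [exact: measurable_start|exact: measurable_at]. Qed.

Lemma joint_step t B : Pr (start `&` at_ t.+1 B) =
  (\sum_(A : S) Pr (start `&` at_ t A) * (K A B)%:E)%E.
Proof.
rewrite (total_probability (Y := X t) Pr (measurable_at t)); last first.
  exact: measurable_start_at.
by apply: eq_bigr => A _; rewrite setIAC flow.
Qed.

Lemma joint_start A : Pr (start `&` at_ 0 A) = (if D A then mu0 A else 0)%:E.
Proof.
case: chain => _ init _; case: ifP => DA.
  rewrite setIidr ?init // => w /= wA.
  by rewrite /start /= wA.
suff -> : start `&` at_ 0 A = set0 by rewrite measure0.
by rewrite -subset0 => w [Dw /= wA]; move: Dw; rewrite /start /= wA DA.
Qed.
End Chain.

(** * Escape through a bottleneck *)

(** A chain on a weighted graph moves to a neighbour with probability proportional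
to the weight of the neighbour.  It starts in the region [far], with probabilities
proportional to the weights.  The good starting states [D] have a
neighbourhood of weight at least [rho]; the other starts are harmless because
their own weight is at most [theta].  The bottleneck is [M], the bound on the
weights just outside [far]. *)
Section Bottleneck.
Context (R : realType) (S : finType) (w : S -> R) (e : rel S) (far D : pred S).
Hypothesis w_gt0 : forall A, 0 < w A.
Hypothesis e_sym : symmetric e.

Let W A := \sum_(B | e A B) w B.
Let K A B := if e A B then w B / W A else 0.
Let wfar := \sum_(A | far A) w A.

Context (mu0 : S -> R) (d : measure_display) (T : measurableType d).
Context (Pr : probability T R) (X : nat -> T -> S).
Hypothesis chain : markov_chain mu0 K Pr X.
Hypothesis mu0E : forall A, mu0 A = if far A then w A / wfar else 0.
Hypothesis wfar_gt0 : 0 < wfar.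
Variables rho theta M : R.
Hypothesis rho_gt0 : 0 < rho.
Hypothesis D_far : forall A, D A -> far A.
Hypothesis D_exits : forall A, D A -> rho <= W A.
Hypothesis theta_ge0 : 0 <= theta.
Hypothesis light_start : forall A, far A -> ~~ D A -> w A <= theta.
Hypothesis M_ge0 : 0 <= M.
Hypothesis light_exit : forall A B, far A -> e A B -> ~~ far B -> w B <= M.

Let start : set T := [set x | D (X 0%N x)].
Let at_ t A : set T := [set x | X t x = A].

Lemma neighbourhood_gt0 A B : e A B -> 0 < W A.
Proof.
move=> eAB; rewrite /W (bigD1 B) //= ltr_pwDl ?w_gt0 //.
by apply: sumr_ge0 => C _; apply: ltW.
Qed.

Lemma kernel_ge0 A B : 0 <= K A B.
Proof.
by rewrite /K; case: ifP => // /neighbourhood_gt0 WA; rewrite divr_ge0 // ltW.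
Qed.

(** Detailed balance: the flow from [A] to [B] is the symmetric [w A * w B]. *)
Lemma stationary B : \sum_A w A * W A * K A B = w B * W B.
Proof.
rewrite (bigID (e B)) /= [X in _ + X]big1 ?addr0; last first.
  by move=> A /negbTE nBA; rewrite /K e_sym nBA mulr0.
rewrite mulr_sumr; apply: eq_bigr => A eBA; rewrite /K e_sym eBA.
have WA : W A != 0 by rewrite gt_eqF // (@neighbourhood_gt0 A B) // e_sym.
by field.
Qed.

Let c := (rho * wfar)^-1.

Lemma domination_gt0 : 0 < c.
Proof. by rewrite invr_gt0 mulr_gt0. Qed.

(** The bound holds initially because [rho <= W A] for good starts, and persists
because its right-hand side is a multiple of the stationary measure. *)
Lemma occupation_bound t A :
  (Pr (start `&` at_ t A) <= (c * (w A * W A))%:E)%E.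
Proof.
elim: t A => [|t IH] A.
  rewrite (joint_start chain) lee_fin mu0E; case: ifP => [DA|_]; last first.
    rewrite mulr_ge0 ?(ltW domination_gt0) // mulr_ge0 ?(ltW (w_gt0 _)) //.
    by apply: sumr_ge0 => B _; apply: ltW.
  have -> : c * (w A * W A) = w A / wfar * (W A / rho).
    by rewrite /c; field; rewrite !gt_eqF.
  rewrite D_far // ler_peMr ?divr_ge0 ?(ltW (w_gt0 _)) ?(ltW wfar_gt0) //.
  by rewrite ler_pdivlMr // mul1r D_exits.
rewrite (joint_step chain).
apply: (@le_trans _ _ (\sum_B (c * (w B * W B) * K B A)%:E)%E).
  apply: lee_sum => B _; rewrite EFinM; apply: lee_wpmul2r; last exact: IH.
  by rewrite lee_fin kernel_ge0.
rewrite sumEFin lee_fin -stationary mulr_sumr.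
by under eq_bigr do rewrite -mulrA.
Qed.

(** The factor [W A] cancels against the denominator of the transition
probability. *)
Lemma flow_bound t A B : far A -> ~~ far B ->
  (Pr (start `&` at_ t A `&` at_ t.+1 B) <= (c * M * w A)%:E)%E.
Proof.
move=> fA fB; rewrite (flow chain).
have c0 := domination_gt0.
apply: (@le_trans _ _ (c * (w A * W A) * K A B)%:E).
  rewrite EFinM; apply: lee_wpmul2r; first by rewrite lee_fin kernel_ge0.
  exact: occupation_bound.
rewrite lee_fin /K; case: ifP => [eAB|_]; last first.
  by rewrite mulr0 !mulr_ge0 // ltW.
have WA := neighbourhood_gt0 eAB.
rewrite [leLHS](_ : _ = c * w A * w B); last by field; rewrite gt_eqF.
rewrite mulrAC; apply: ler_wpM2r; first exact: ltW.
by apply: ler_wpM2l; [exact: ltW|exact: light_exit eAB fB].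
Qed.

Definition exit t : set T :=
  start `&` [set x | far (X t x)] `&` [set x | ~~ far (X t.+1 x)].

Lemma measurable_state (Q : pred S) t : measurable [set x | Q (X t x)].
Proof.
by apply: (measurable_finite_event (Y := X t)) => A; exact: measurable_at chain _ _.
Qed.

Lemma measurable_exit t : measurable (exit t).
Proof.
apply: measurableI; last exact: (measurable_state (predC far)).
by apply: measurableI; apply: measurable_state.
Qed.

Lemma exit_bound t : (Pr (exit t) <= (#|S|%:R * M / rho)%:E)%E.
Proof.
have mX i A : measurable (at_ i A) by exact: measurable_at chain _ _.
rewrite (total_probability (Y := X t) Pr (mX t)); last exact: measurable_exit.
pose bnd A := if far A then #|S|%:R * (c * M * w A) else 0.
apply: (@le_trans _ _ (\sum_A (bnd A)%:E)%E); last first.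
  rewrite sumEFin lee_fin -big_mkcond /= -!mulr_sumr -/wfar /c.
  rewrite le_eqVlt; apply/orP; left; apply/eqP.
  by field; rewrite !gt_eqF.
apply: lee_sum => A _; rewrite /bnd; case: ifP => fA; last first.
  suff -> : exit t `&` at_ t A = set0 by rewrite measure0.
  by rewrite -subset0 => x [[[_ /= fx] _] /= xA]; rewrite xA fA in fx.
have mE : measurable (exit t `&` at_ t A).
  by apply: measurableI => //; exact: measurable_exit.
rewrite (total_probability (Y := X t.+1) Pr (mX t.+1) mE).
rewrite mulr_natl -sumr_const -sumEFin; apply: lee_sum => B _.
have [fB|fB] := boolP (far B).
  have -> : exit t `&` at_ t A `&` at_ t.+1 B = set0.
    by rewrite -subset0 => x [[[_ /= fx] _] /= xB]; rewrite xB fB in fx.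
  by rewrite measure0 lee_fin !mulr_ge0 // ltW // domination_gt0.
apply: le_trans (flow_bound t fA fB); apply: le_measure; rewrite ?inE.
- by apply: measurableI => //; exact: mX.
- by apply: measurableI; [exact: (measurable_start_at chain)|exact: mX].
by move=> x [[[[? _] _] ?] ?].
Qed.

Lemma start_bound : (Pr (~` start) <= (#|S|%:R * theta / wfar)%:E)%E.
Proof.
have mX i A : measurable (at_ i A) by exact: measurable_at chain _ _.
have mS : measurable start by exact: measurable_state.
rewrite (total_probability (Y := X 0%N) Pr (mX 0%N)); last exact: measurableC.
rewrite -mulrA mulr_natl -sumr_const -sumEFin; apply: lee_sum => A _.
have [DA|nDA] := boolP (D A).
  suff -> : ~` start `&` at_ 0 A = set0.
    by rewrite measure0 lee_fin divr_ge0 // ltW.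
  by rewrite -subset0 => x [nDx /= xA]; apply: nDx; rewrite /start /= xA.
have -> : ~` start `&` at_ 0 A = at_ 0 A.
  by apply: setIidr => x /= xA; rewrite /start /= xA; apply/negP.
case: chain => _ -> _; rewrite lee_fin mu0E.
case: ifP => fA; last by rewrite divr_ge0 // ltW.
by rewrite ler_pM2r ?invr_gt0 // light_start.
Qed.

Let staying N := start `&` [set x | forall t, (t <= N)%N -> far (X t x)].

Lemma measurable_staying N : measurable (staying N).
Proof.
apply: measurableI; first exact: measurable_state.
have -> : [set x | forall t, (t <= N)%N -> far (X t x)] =
    \bigcap_(t in [set t | (t <= N)%N]) [set x | far (X t x)] by [].
by apply: bigcap_measurableType => t _; apply: measurable_state.
Qed.

(** A good start that stays up to time [N] but not up to [N + 1] exits at time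
[N]. *)
Lemma leaving_bound N : (Pr (~` staying N) <=
  (#|S|%:R * theta / wfar + N%:R * (#|S|%:R * M / rho))%:E)%E.
Proof.
have mS : measurable start by exact: measurable_state.
elim: N => [|N IH].
  rewrite mul0r addr0; apply: le_trans start_bound.
  apply: le_measure; rewrite ?inE; [|exact: measurableC|].
    exact/measurableC/measurable_staying.
  move=> x nst Dx; apply: nst; split=> // t; rewrite leqn0 => /eqP->.
  exact: D_far.
have mN : measurable (~` staying N) by exact/measurableC/measurable_staying.
have mE : measurable (exit N `&` staying N).
  by apply: measurableI; [exact: measurable_exit|exact: measurable_staying].
apply: (@le_trans _ _ (Pr (~` staying N `|` (exit N `&` staying N)))).
  apply: le_measure; rewrite ?inE.
  - exact/measurableC/measurable_staying.
  - exact: measurableU.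
  move=> x nst; have [[Dx stN]|] := pselect (staying N x); last by left.
  right; split=> //; split; first by split=> //; apply: stN.
  apply/negP=> /= fx; apply: nst; split=> // t.
  by rewrite leq_eqVlt ltnS => /orP[/eqP-> //|/stN].
rewrite measureU //; last by rewrite setICA setICl setI0.
rewrite -natr1 mulrDl mul1r addrA EFinD; apply: leeD IH _.
apply: le_trans (exit_bound N); apply: le_measure; rewrite ?inE //.
exact: measurable_exit.
Qed.

Lemma stay_far N :
  ((1 - (#|S|%:R * theta / wfar + N%:R * (#|S|%:R * M / rho)))%:E <=
  Pr [set x | forall t, (t <= N)%N -> far (X t x)])%E.
Proof.
apply: (@le_trans _ _ (Pr (staying N))); last first.
  apply: le_measure; rewrite ?inE; [exact: measurable_staying| |by move=> x []].
  have -> : [set x | forall t, (t <= N)%N -> far (X t x)] =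
    \bigcap_(t in [set t | (t <= N)%N]) [set x | far (X t x)] by [].
  by apply: bigcap_measurableType => t _; apply: measurable_state.
rewrite -[staying N]setCK probability_setC; last first.
  exact/measurableC/measurable_staying.
by rewrite EFinB; apply: leeB => //; exact: leaving_bound.
Qed.
End Bottleneck.

(** * The chain under the overlap gap property *)

Section Gap.
Context (R : realType) (n k : nat) (P : kpart n k) (nu1 nu2 c1 c2 beta : R).
Variable G : sgraph n.

Let q (A : kpart n k) : R := kmodularity R G A.

(** [P] itself makes the maximum range over a nonempty set. *)
Lemma qstar_real : exists Q : R, qstar R G = Q%:E.
Proof.
have : qstar R G \is a fin_num; last by move/fineK => <-; eexists.
rewrite fin_numE; apply/andP; split.
  have /andP[Ppart _] := valP P.
  rewrite gt_eqF // (lt_le_trans (ltNyr (q P))) //.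
  exact: (le_bigmax_cond _ (fun A => (modularity R G A)%:E)).
rewrite /qstar; elim/big_ind: _ => // x y xfin yfin.
by rewrite /maxe; case: ifP.
Qed.

Lemma gap_real : overlap_gap P nu1 nu2 c1 c2 G ->
  exists Q : R,
    (exists2 A, E_far P nu2 A & Q - c1 <= q A) /\
    (forall A, E_btw P nu1 nu2 A -> q A <= Q - c1 - c2).
Proof.
case=> _; have [Q ->] := qstar_real; move=> far_high btw_low; exists Q; split.
  apply/not_exists2P => none; move: far_high; apply/negP; rewrite -ltNge.
  apply: bigmax_lt; first exact: ltNyr.
  move=> A fA; rewrite -EFinB lte_fin ltNge; apply/negP=> qA.
  by case: (none A).
move=> A bA; rewrite -lee_fin !EFinB; apply: le_trans btw_low.
exact: (le_bigmax_cond _ (fun A => (kmodularity R G A)%:E)).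
Qed.

(** The partition function cancels. *)
Lemma initialE (A : kpart n k) : initial G beta P nu2 A =
  if E_far P nu2 A then boltzmann G beta A /
     \sum_(B | E_far P nu2 B) boltzmann G beta B else 0.
Proof.
rewrite /initial; case: ifP => // _; rewrite /gibbs -mulr_suml.
set Z := \sum_(B : kpart n k) _.
have Z0 : Z != 0.
  rewrite gt_eqF // /Z (bigD1 A) //= ltr_pwDl ?expR_gt0 //.
  by apply: sumr_ge0 => B _; exact: expR_ge0.
by rewrite invfM invrK [_ * Z]mulrC mulrA divfK.
Qed.

Lemma hitting_time_ge (S T : Type) (X : nat -> T -> S) (D : pred S) (s : R) x :
  (s%:E <= hitting_time R X D x)%E <-> (forall t, t%:R < s -> ~~ D (X t x)).
Proof.
rewrite /hitting_time; split=> [/ereal_infP h t ts|h].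
  apply/negP=> Dt; have := h _ (ex_intro2 _ _ t Dt erefl).
  by rewrite lee_fin leNgt ts.
apply/ereal_infP => _ [t /= Dt <-]; rewrite lee_fin leNgt.
by apply/negP=> /h; rewrite Dt.
Qed.

(** The constants are [c3 = 1] and [c4 = 1 / 2].  With [x = beta * n * c2 / 2] and
at most [k ^ n <= expR (x - 2 * n)] partitions, a bad start has probability at
most [expR (- 2 * n)], and an exit at a given time at most
[expR (5 * beta - 2 * n)]; there are at most [expR n] times to consider. *)
Lemma slow_hitting : (2 <= k)%N -> (2 <= n)%N ->
  1 / n%:R < nu2 - nu1 -> 0 < c2 -> 0 < beta ->
  2 * (ln k%:R + 2) <= beta * c2 -> 10 * beta + 2 <= n%:R ->
  overlap_gap P nu1 nu2 c1 c2 G ->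
  hitting_prob_ge P nu1 nu2 beta (expR (1 * n%:R)) (1 - expR (- (1 / 2 * n%:R))) G.
Proof.
move=> k2 n2 small_step c2_gt0 beta_gt0 beta_large n_large gap.
have [Q [[A0 far0 q0] btw_low]] := gap_real gap.
move=> d T Pr X chain.
have n_gt0 : 0 < n%:R :> R by rewrite ltr0n ltnW.
pose w := @boltzmann R n k G beta.
pose e (A B : kpart n k) := dist R A B == 1 / n%:R.
pose far := E_far P nu2.
pose D A := far A && (Q - c1 - c2 / 2 <= q A).
pose bn := beta * n%:R.
have bn_gt0 : 0 < bn by rewrite mulr_gt0.
pose theta := expR (bn * (Q - c1 - c2 / 2)).
pose M := expR (bn * (Q - c1 - c2)).
pose rho := expR (bn * (Q - c1 - c2 / 2) - 5 * beta).
have w_gt0 A : 0 < w A by exact: expR_gt0.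
have e_sym : symmetric e by move=> A B; rewrite /e dist_sym.
have D_far A : D A -> far A by case/andP.
(* the neighbour of [A] given by [neighbour_exists] already has this weight *)
have D_exits A : D A -> rho <= \sum_(B | e A B) w B.
  case/andP=> _ qA; have [B [eAB qB]] := neighbour_exists R G A n2 k2.
  rewrite (bigD1 B) /e ?eAB //=; apply: ler_wpDr.
    by apply: sumr_ge0 => C _; apply: ltW.
  rewrite /rho /w /boltzmann ler_expR -/bn.
  have -> : 5 * beta = bn * (5 / n%:R) by rewrite /bn; field; rewrite gt_eqF.
  rewrite -mulrBr ler_pM2l //; apply: le_trans qB.
  by rewrite lerD2r.
have light_start A : far A -> ~~ D A -> w A <= theta.
  rewrite /D => -> /=; rewrite -ltNge => qA.
  by rewrite /w /theta ler_expR ler_pM2l // ltW.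
(* one step from the far region cannot jump over the gap *)
have light_exit A B : far A -> e A B -> ~~ far B -> w B <= M.
  move=> fA /eqP eAB fB; rewrite /w /M ler_expR ler_pM2l //; apply: btw_low.
  rewrite /E_btw; apply/andP; split; last by rewrite ltNge.
  have n0 : (0 < n)%N by rewrite ltnW.
  have := dist_triangle R n0 P B A; rewrite (dist_sym R B A) eAB.
  by move: fA; rewrite /far /E_far => fA h; lra.
pose wfar := \sum_(A | far A) w A.
have wfar_ge : expR (bn * (Q - c1)) <= wfar.
  rewrite /wfar (bigD1 A0) //=; apply: ler_wpDr.
    by apply: sumr_ge0 => C _; apply: ltW.
  by rewrite /w /boltzmann ler_expR ler_pM2l.
have wfar_gt0 : 0 < wfar by apply: lt_le_trans wfar_ge; exact: expR_gt0.
pose N := Num.truncn (expR (n%:R : R)).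
have stay := @stay_far R _ w e far D w_gt0 e_sym _ d T Pr X chain initialE
  wfar_gt0 rho theta M (expR_gt0 _) D_far D_exits (expR_ge0 _) light_start
  (expR_ge0 _) light_exit N.
have hitE : [set x | ((expR (1 * n%:R))%:E <=
      hitting_time R X (E_close P nu1) x)%E] =
    \bigcap_(t in [set t : nat | t%:R < expR (n%:R : R)])
      [set x | predC (E_close P nu1) (X t x)].
  by apply/seteqP; split=> x /=; rewrite mul1r => /hitting_time_ge.
apply: (@le_trans _ _ (Pr [set x | forall t, (t <= N)%N -> far (X t x)])); last first.
  apply: le_measure; rewrite ?inE.
  - have -> : [set x | forall t, (t <= N)%N -> far (X t x)] =
      \bigcap_(t in [set t | (t <= N)%N]) [set x | far (X t x)] by [].
    by apply: bigcap_measurableType => t _; exact: (measurable_state chain).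
  - rewrite hitE; apply: bigcap_measurableType => t _.
    exact: (measurable_state chain (predC _)).
  rewrite hitE => x stays t /= tn; rewrite /E_close -ltNge.
  have /stays : (t <= N)%N by rewrite truncn_ge_nat ?ltW // expR_ge0.
  have : 0 < 1 / n%:R :> R by rewrite divr_gt0.
  by rewrite /far /E_far; lra.
apply: le_trans stay; rewrite lee_fin lerD2l lerN2.
pose L : R := ln k%:R.
pose x := bn * (c2 / 2).
have x_large : n%:R * L - x <= - 2 * n%:R.
  have -> : x = n%:R / 2 * (beta * c2) by rewrite /x /bn; ring.
  have : n%:R / 2 * (2 * (L + 2)) <= n%:R / 2 * (beta * c2).
    by rewrite ler_pM2l ?divr_gt0.
  lra.
have card_le : #|{: kpart n k}|%:R <= expR (n%:R * L).
  rewrite expRM_natl lnK ?posrE ?ltr0n 1?ltnW // -natrX ler_nat.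
  exact: card_kpart.
have start_le : theta / wfar <= expR (- x).
  rewrite ler_pdivrMr //; apply: le_trans (ler_wpM2l (expR_ge0 _) wfar_ge).
  by rewrite -expRD ler_expR /x; lra.
have exit_le : M / rho <= expR (5 * beta - x).
  by rewrite ler_pdivrMr ?expR_gt0 // -expRD ler_expR /x; lra.
have N_le : N%:R <= expR (n%:R : R) by rewrite truncn_le expR_ge0.
have {}start_le : #|{: kpart n k}|%:R * theta / wfar <= expR (5 * beta - n%:R).
  rewrite -mulrA; apply: le_trans (ler_pM _ _ card_le start_le) _ => //.
    by rewrite divr_ge0 ?expR_ge0 // ltW.
  by rewrite -expRD ler_expR; lra.
have {}exit_le : N%:R * (#|{: kpart n k}|%:R * M / rho) <= expR (5 * beta - n%:R).
  have : #|{: kpart n k}|%:R * M / rho <= expR (n%:R * L + (5 * beta - x)).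
    rewrite -mulrA expRD; apply: ler_pM => //.
    by rewrite divr_ge0 ?expR_ge0.
  move=> {}exit_le; apply: le_trans (ler_pM _ _ N_le exit_le) _ => //.
    by rewrite divr_ge0 ?mulr_ge0 ?expR_ge0.
  by rewrite -expRD ler_expR; lra.
apply: le_trans (lerD start_le exit_le) _.
(* the factor 2 costs one unit in the exponent *)
have two_le : 2 <= expR (1 : R) by have := expR_ge1Dx (1 : R); lra.
rewrite -mulr2n -[leLHS]mulr_natl.
apply: le_trans (ler_wpM2r (expR_ge0 _) two_le) _.
by rewrite -expRD ler_expR; lra.
Qed.
End Gap.

Lemma sbm_prob_mono (R : realType) n k (P : kpart n k) (p q : R)
    (E F : sgraph n -> Prop) :
  0 <= p <= 1 -> 0 <= q <= 1 -> (forall G, E G -> F G) ->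
  sbm_prob P p q E <= sbm_prob P p q F.
Proof.
move=> /andP[p0 p1] /andP[q0 q1] EF.
rewrite /sbm_prob big_mkcond [leRHS]big_mkcond /=; apply: ler_sum => G _.
have wG : 0 <= sbm_weight P p q G.
  apply: prodr_ge0 => e _; rewrite /edge_prob.
  by case: ifP => _; case: ifP => _; rewrite ?subr_ge0.
case: asboolP => [EG|_]; case: asboolP => [FG|nF] //.
by case: nF; apply: EF.
Qed.

Theorem theoremB2 (R : realType) (a b : R) (k : nat)
    (eps nu1 nu2 c c1 c2 : R) :
  0 < b -> b < a -> (3 <= k)%N -> 0 < eps ->
  0 < nu1 -> nu1 < nu2 -> nu2 < 1 -> 0 < c -> 0 < c1 -> 0 < c2 ->
  (forall omega : nat -> R, admissible a c omega ->
     \forall n \near \oo, forall P : kpart n k, balanced P ->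
       1 - eps <= sbm_prob P (omega n * a / n%:R) (omega n * b / n%:R)
                    (overlap_gap P nu1 nu2 c1 c2)) ->
  exists2 beta0 : R, 0 < beta0 & forall beta : R, beta0 <= beta ->
    exists c3 c4 : R, [/\ 0 < c3, 0 < c4 &
      forall omega : nat -> R, admissible a c omega ->
        \forall n \near \oo, forall P : kpart n k, balanced P ->
          1 - eps <= sbm_prob P (omega n * a / n%:R) (omega n * b / n%:R)
                       (hitting_prob_ge P nu1 nu2 beta
                          (expR (c3 * n%:R)) (1 - expR (- (c4 * n%:R))))].
Proof.
move=> b_gt0 ba k3 _ _ nu12 _ c_gt0 _ c2_gt0 gap.
have k2 : (2 <= k)%N by rewrite ltnW.
have lnk : 0 <= ln (k%:R : R) by rewrite ln_ge0 // ler1n ltnW.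
exists (2 * (ln k%:R + 2) / c2); first by rewrite divr_gt0 // mulr_gt0 // ltr_wpDl.
move=> beta; rewrite ler_pdivrMr // => beta_large.
have beta_gt0 : 0 < beta.
  have : 0 < beta * c2 by lra.
  by rewrite pmulr_lgt0.
exists 1, (1 / 2); split=> // omega adm.
have gap_pos : 0 < nu2 - nu1 by rewrite subr_gt0.
near=> n => P bP.
have n2 : (2 <= n)%N by near: n; exact: nbhs_infty_ge.
have n_gt0 : 0 < n%:R :> R by rewrite ltr0n ltnW.
have small_step : 1 / n%:R < nu2 - nu1.
  rewrite ltr_pdivrMr // mulrC -ltr_pdivrMr //.
  by near: n; exact: nbhs_infty_gtr.
have n_large : 10 * beta + 2 <= n%:R by near: n; exact: nbhs_infty_ger.
have [c_om pa] : c < omega n /\ omega n * a / n%:R <= 1 by near: n; exact: adm.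
have om_gt0 : 0 < omega n by exact: lt_trans c_om.
have a_gt0 : 0 < a by exact: lt_trans ba.
have gapP : 1 - eps <= sbm_prob P (omega n * a / n%:R) (omega n * b / n%:R)
    (overlap_gap P nu1 nu2 c1 c2).
  move: P bP; near: n; exact: gap.
apply: le_trans gapP _; apply: sbm_prob_mono.
- by rewrite pa andbT !mulr_ge0 ?invr_ge0 // ltW.
- apply/andP; split; first by rewrite !mulr_ge0 ?invr_ge0 // ltW.
  apply: le_trans pa.
  by rewrite ler_pM2r ?invr_gt0 // ler_pM2l // ltW.
by move=> G; apply: slow_hitting.
Unshelve. all: by end_near.
Qed.
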